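(* Let $f,g\in L^\infty$. Then $S_{f,g}$ is normal if and only if one of the following statements holds. (1) $f$ and $g$ are constants. (2) There exists a unimodular constant $\lambda$ such that $f-\lambda g$ and $\lambda\bar fg-f\bar g$ are constants.
   Context: $L^2$ and $L^\infty$ are the Lebesgue spaces of the unit circle $\mathbb T$ with normalized Lebesgue measure. $H^2\subset L^2$ is the Hardy space, $P_+$ is the orthogonal projection of $L^2$ onto $H^2$, and $P_-=I-P_+$. For $f,g\in L^\infty$ the singular integral operator $S_{f,g}$ on $L^2$ is $S_{f,g}x=fP_+x+gP_-x$. A bar denotes complex conjugation. *)

(* Defs.v *)
From HB Require Import structures.
From mathcomp Require Import all_boot all_order all_algebra.
From mathcomp Require Import all_classical all_reals all_analysis.
From mathcomp Require Import measurable_realfun complex.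

Set Implicit Arguments.
Unset Strict Implicit.
Unset Printing Implicit Defensive.

Import Order.TTheory GRing.Theory Num.Theory.
Import numFieldNormedType.Exports.

Local Open Scope classical_set_scope.
Local Open Scope ring_scope.
Local Open Scope complex_scope.

Section UnitCircle.
Variable R : realType.

Definition unimodular : Type := {z : R[i] | `|z| == 1}.

HB.instance Definition _ :=
  SubChoice.copy unimodular {z : R[i] | `|z| == 1}.

Lemma unimodular1_subproof : `|1 : R[i]| == 1.
Proof. by rewrite normr1. Qed.

HB.instance Definition _ :=
  isPointed.Build unimodular (exist _ (1 : R[i]) unimodular1_subproof).

Definition unimodular_coord (z : unimodular) : R * R :=
  (complex.Re (val z), complex.Im (val z)).

(* The unit circle with its Borel sigma-algebra, obtained as the trace of the
   Borel sigma-algebra of R * R. *)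
Definition circle : Type := g_sigma_algebra_preimageType unimodular_coord.
HB.instance Definition _ := Measurable.on circle.

Lemma cis_subproof (t : R) : `|cos t +i* sin t| == 1.
Proof. by rewrite normc_def /= cos2Dsin2 sqrtr1. Qed.

Definition cis (t : measurableTypeR R) : circle :=
  exist _ (cos t +i* sin t) (cis_subproof t).

Lemma measurable_cis : measurable_fun [set: measurableTypeR R] cis.
Proof.
move=> _ _ [B mB <-]; rewrite !setTI -[X in measurable X]setTI.
have mf : measurable_fun [set: R] (fun t : R => (cos t, sin t)).
  apply: measurable_fun_pair.
    exact: (continuous_measurable_fun (@continuous_cos R)).
  exact: (continuous_measurable_fun (@continuous_sin R)).
exact: mf.
Qed.

HB.instance Definition _ := isMeasurableFun.Build _ _ _ _ cis measurable_cis.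

Lemma twopi_gt0 : 0 < 2 * pi :> R.
Proof. by rewrite mulr_gt0 ?pi_gt0. Qed.

(* Normalized Lebesgue (arc length) measure: the image of dt / (2 pi) on
   [0, 2 pi] under t |-> exp (i t). *)
Definition circle_measure : probability circle R :=
  distribution (uniform_prob twopi_gt0) cis.

End UnitCircle.

Section HardySpace.
Variable R : realType.
Local Notation C := R[i].
Local Notation mu := (circle_measure R).

(* Elements of L^p are represented by functions, equality in L^p being equality
   mu-almost everywhere. *)
Implicit Types x y f g : circle R -> C.
Implicit Types S A : (circle R -> C) -> (circle R -> C).

Definition Lp (p : \bar R) : set (circle R -> C) :=
  [set x : circle R -> C |
    [/\ measurable_fun setT (fun z => complex.Re (x z) : R),
        measurable_fun setT (fun z => complex.Im (x z) : R) &
        finite_norm mu p (fun z => Normc.normc (x z))]].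

Definition L2 := Lp 2%:E.

Definition Linfty := Lp +oo.

Definition cintegral x : C :=
  (\int[mu]_z complex.Re (x z))%R +i* (\int[mu]_z complex.Im (x z))%R.

Definition inner x y : C := cintegral (fun z => x z * (y z)^*).

Definition fourier x (n : int) : C :=
  inner x (fun z => val z ^ n).

Definition H2 : set (circle R -> C) :=
  [set x : circle R -> C | L2 x /\ forall n : int, n < 0 -> fourier x n = 0].

(* The orthogonal projection onto H2: Pplus x is the element of H2, unique up to
   mu-almost everywhere equality, such that x - Pplus x is orthogonal to H2. *)
Definition Pplus x : circle R -> C :=
  xget (cst 0)
    [set y : circle R -> C | H2 y /\ forall h, H2 h -> inner (x \- y) h = 0].

Definition Pminus x : circle R -> C := x \- Pplus x.

Definition singular_integral f g x : circle R -> C :=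
  f \* Pplus x \+ g \* Pminus x.

Definition adjoint S A :=
  (forall y, L2 y -> L2 (A y)) /\
  (forall x y, L2 x -> L2 y -> inner (S x) y = inner x (A y)).

Definition normal_operator S :=
  exists A, adjoint S A /\
    forall x, L2 x -> S (A x) = A (S x) %[ae mu].

Definition is_constant f := exists c : C, f = cst c %[ae mu].

End HardySpace.

(* Main.v *)
From HB Require Import structures.
From mathcomp Require Import all_boot all_order all_algebra.
From mathcomp Require Import all_classical all_reals all_analysis.
From mathcomp Require Import measurable_realfun ess_sup_inf complex ring lra.
Require Import Defs.

Set Implicit Arguments.
Unset Strict Implicit.
Unset Printing Implicit Defensive.

Import Order.TTheory GRing.Theory Num.Theory.
Import numFieldNormedType.Exports.

Local Open Scope classical_set_scope.
Local Open Scope complex_scope.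
Local Open Scope ring_scope.

(** Let M_f be multiplication by f, P = P_+, S = M_f P + M_g (I - P) and
    e(z) = 1/z. An adjoint of S is P M_conj(f) + (I - P) M_conj(g), so S is normal
    if and only if <S* x, S* y> = <S x, S y> for all x and y in L^2
    (normal_singopP). Both implications are proved on this identity.

    The identity is compared at (z x, z y) and at (x, y). Multiplication by z
    preserves the inner product and commutes with multiplications, and it almost
    commutes with P: P (z x) = z P x + <x, e> 1 (ip_proj_shift). The difference is
    therefore an identity between forms of finite rank (rank_identity): with
    F = f e, G = g e and d = F - G,
      <x, F> conj<y, F> - <x, G> conj<y, G>
        = <x, e> conj<S y, d> + conj<y, e> <S x, d> + <x, e> conj<y, e> <d, d>.
    On the orthogonal complement of e the right-hand side is zero. So the parts of
    F and G orthogonal to e define the same rank one form and differ by a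
    unimodular factor lambda (residual_proportional): f - lambda g is a constant k.
    Taking y = e and x orthogonal to e now gives
    <S x, d> = conj(lambda) k <x, G>. Tested on H^2, where S is M_f, and on its
    orthogonal complement, where S is M_g, this says that
    (f conj(g) - lambda conj(f) g) e is orthogonal to every x orthogonal to e
    (cross_term_constant), so f conj(g) - lambda conj(f) g is constant.

    Conversely, the two relations turn the identity of forms into a computation
    (relations_normal), in which the constant value of the second function only
    multiplies inner products of a vector of H^2 with one orthogonal to H^2. When
    f and g are constants, the relations hold with lambda = 1.

    The operator P is specified by orthogonality, so its values on L^2 have to be
    shown to exist: this is the projection theorem (orthogonal_projection), based
    on the completeness of L^2 (Lfun2_complete). The only computation with
    trigonometric functions is that the positive powers of z have mean zero
    (circle_exp_mean), which puts the constant 1 in H^2. *)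

(** * Real square-integrable functions *)

Section Lfun2.
Context d (T : measurableType d) (R : realType).
Variable mu : {measure set T -> \bar R}.
Implicit Types f g : T -> R.

Lemma Lfun2P f : f \in Lfun mu 2%:E <->
  measurable_fun setT f /\ (\int[mu]_t (f t ^+ 2)%:E < +oo)%E.
Proof.
split=> [/[dup] fL /[!inE] /andP[/[!inE]/= mf _]|[mf foo]].
  split=> //; have /integrableP[_] := Lfun2_integrable_sqr fL.
  by under eq_integral do rewrite /= ger0_norm ?sqr_ge0//.
rewrite inE; apply/andP; split; rewrite inE//= /finite_norm unlock /Lnorm.
rewrite poweR_lty//; under eq_integral do rewrite /= powR_mulrn// -normrX.
by under eq_integral do rewrite ger0_norm ?sqr_ge0//.
Qed.

Lemma Lfun2_measurable f : f \in Lfun mu 2%:E -> measurable_fun setT f.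
Proof. by move=> /Lfun2P[]. Qed.

Lemma Lfun2_dominated f g : measurable_fun setT f -> g \in Lfun mu 2%:E ->
  (\forall t \ae mu, `|f t| <= `|g t|) -> f \in Lfun mu 2%:E.
Proof.
move=> mf /Lfun2P[mg goo] fg; apply/Lfun2P; split=> //.
apply: le_lt_trans goo; apply: ae_ge0_le_integral => //.
- by move=> t _; rewrite lee_fin sqr_ge0.
- by apply/measurable_EFinP; exact: measurable_funX.
- by move=> t _; rewrite lee_fin sqr_ge0.
- by apply/measurable_EFinP; exact: measurable_funX.
- apply: filterS fg => t fgt _; rewrite lee_fin.
  by rewrite -real_normK ?num_real// -[leRHS]real_normK ?num_real// lerXn2r// nnegrE.
Qed.

Lemma Lfun2_mul_integrable f g : f \in Lfun mu 2%:E -> g \in Lfun mu 2%:E ->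
  mu.-integrable setT (EFin \o (f \* g)).
Proof. by move=> fL gL; apply/Lfun1_integrable; exact: Lfun2_mul_Lfun1. Qed.

Lemma Lfun2_lin a f g : f \in Lfun mu 2%:E -> g \in Lfun mu 2%:E ->
  (fun t => a * f t + g t) \in Lfun mu 2%:E.
Proof.
have p1 : (1 <= 2%:E :> \bar R)%E by rewrite lee_fin ler1n.
by move=> fL gL; have := (Lfun_submod_closed mu p1).2 a f g fL gL.
Qed.

End Lfun2.

(** * Completeness of real L^2 *)

Section RieszFischer.
Context d (T : measurableType d) (R : realType).
Variable mu : probability T R.
Variable u : nat -> T -> R.
Hypothesis uL : forall n, u n \in Lfun mu 2%:E.
Hypothesis u_fast : forall n m, (n <= m)%N ->
  (\int[mu]_t ((u m t - u n t) ^+ 2)%:E <= (4^-1 ^+ n)%:E)%E.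

Let mu_ n : measurable_fun setT (u n) := Lfun2_measurable (uL n).

Let w n t : R := `|u n.+1 t - u n t|.

Let mw n : measurable_fun setT (w n).
Proof. by apply: measurableT_comp => //; exact: measurable_funB. Qed.

(* AM-GM in the form w <= (2^n w^2 + 2^-n) / 2 turns the L^2 bounds 4^-n on the
   squared increments into summable L^1 bounds 2^-n. *)
Let int_w n : (\int[mu]_t (w n t)%:E <= (2^-1 ^+ n)%:E)%E.
Proof.
have -> : 2^-1 ^+ n = 2^-1 * 2 ^+ n * 4^-1 ^+ n + 2^-1 * 2^-1 ^+ n :> R.
  rewrite -mulrA -exprMn (_ : 2 * 4^-1 = 2^-1 :> R); first by field.
  by field.
have mw2 : measurable_fun setT (fun t => (u n.+1 t - u n t) ^+ 2).
  by apply: measurable_funX; exact: measurable_funB.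
have h : (\int[mu]_t (2^-1 * 2 ^+ n * (u n.+1 t - u n t) ^+ 2 + 2^-1 * 2^-1 ^+ n)%:E <=
    (2^-1 * 2 ^+ n * 4^-1 ^+ n + 2^-1 * 2^-1 ^+ n)%:E)%E.
  under eq_integral do rewrite EFinD EFinM.
  rewrite ge0_integralD//=; last 2 first.
  - by move=> t _; rewrite mule_ge0// lee_fin ?sqr_ge0// mulr_ge0// exprn_ge0.
  - by apply: measurable_funeM; exact/measurable_EFinP.
  rewrite ge0_integralZl//=; [|exact/measurable_EFinP|by move=> t _; rewrite lee_fin sqr_ge0].
  rewrite integral_cst//= probability_setT mule1 EFinD leeD2r// [leRHS]EFinM.
  by rewrite lee_wpmul2l ?u_fast// lee_fin mulr_ge0// exprn_ge0.
apply: le_trans h; apply: ge0_le_integral => //.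
- by move=> t _; rewrite lee_fin normr_ge0.
- exact/measurable_EFinP.
- apply/measurable_EFinP; apply: measurable_funD => //.
  by apply: measurable_funM.
- move=> t _; rewrite lee_fin /w -[in leRHS]real_normK ?num_real//.
  move: `|u n.+1 t - u n t| => r.
  have -> : 2^-1 ^+ n = (2 ^+ n)^-1 :> R by rewrite exprVn.
  have : (0 : R) < 2 ^+ n by rewrite exprn_gt0.
  move: (2 ^+ n) => a a0.
  rewrite -subr_ge0 (_ : _ - _ = 2^-1 * a^-1 * (a * r - 1) ^+ 2).
    by rewrite mulr_ge0 ?sqr_ge0// mulr_ge0// invr_ge0 ltW.
  by field; rewrite gt_eqF.
Qed.

(* The increments have a finite L^1 sum, so their sum is finite almost
   everywhere, and the telescoping series converges absolutely there. *)
Let ae_cvg : \forall t \ae mu, cvgn (fun n => u n t).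
Proof.
have : mu.-integrable setT (fun t => \sum_(n <oo) (w n t)%:E)%E.
  apply/integrableP; split.
    apply: ge0_emeasurable_sum => [n t _ _|n _]; first by rewrite lee_fin normr_ge0.
    exact/measurable_EFinP.
  under eq_integral => t _.
    rewrite gee0_abs; last by apply: nneseries_ge0 => n _ _; rewrite lee_fin normr_ge0.
    over.
  rewrite integral_nneseries//; last 2 first.
  - by move=> n; exact/measurable_EFinP.
  - by move=> n t _; rewrite lee_fin normr_ge0.
  apply: (@le_lt_trans _ _ (\sum_(n <oo) (2^-1 ^+ n)%:E)%E).
    apply: lee_nneseries => [n *|n *]; last exact: int_w.
    by apply: integral_ge0 => t _; rewrite lee_fin normr_ge0.
  have := @cvg_geometric_series R 1 2^-1; rewrite ger0_norm// invf_lt1// ltr1n => /(_ isT) h.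
  rewrite (_ : (fun _ => _) = EFin \o series (geometric 1 2^-1)); last first.
    apply/funext => n /=; rewrite /series /= sumEFin; congr EFin.
    by apply: eq_bigr => i _; rewrite mul1r.
  have /cvg_lim -> // : (EFin \o series (geometric 1 2^-1)) @ \oo --> (1 / (1 - 2^-1) : R)%:E.
    by apply: cvg_EFin h; exact: nearW.
  by rewrite ltry.
move=> /integrable_ae -/(_ measurableT); apply: filterS => t /(_ I) fin.
have : cvgn (series (fun n => u n.+1 t - u n t)).
  have wE : [normed series (fun n => u n.+1 t - u n t)] =
      (fun n => \sum_(0 <= k < n) w k t) by [].
  apply: normed_cvg; rewrite wE; apply: nondecreasing_is_cvgn.
    by apply/nondecreasing_seqP => n; rewrite big_nat_recr//= lerDl normr_ge0.
  exists (fine (\sum_(n <oo) (w n t)%:E)%E) => _ [n _ <-].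
  rewrite -lee_fin fineK// -sumEFin.
  by apply: nneseries_lim_ge => k _ _; rewrite lee_fin normr_ge0.
have -> : series (fun n => u n.+1 t - u n t) = (fun n => u n t - u 0%N t).
  by apply/funext => n; rewrite /series /= telescope_sumr.
move=> h; have : cvgn (fun n => (u n t - u 0%N t) + u 0%N t).
  by apply: is_cvgD => //; exact: is_cvg_cst.
by under eq_fun do rewrite subrK.
Qed.

(** Riesz-Fischer for a fast Cauchy sequence: it converges almost everywhere,
    and Fatou's lemma, applied to m |-> (u m - u n)^2, carries the bound on
    ||u m - u n||^2 over to the pointwise limit. *)
Lemma Lfun2_complete : exists v, v \in Lfun mu 2%:E /\
  forall n, (\int[mu]_t ((v t - u n t) ^+ 2)%:E <= (4^-1 ^+ n)%:E)%E.
Proof.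
(* The upper limit is measurable, and is the limit wherever a limit exists. *)
pose v t := fine (limn_esup (fun n => (u n t)%:E)).
have mv : measurable_fun setT v.
  apply: measurableT_comp => //; apply: measurable_fun_limn_esup => n.
  exact/measurable_EFinP.
have uv : \forall t \ae mu, u n t @[n --> \oo] --> v t.
  apply: filterS ae_cvg => t /cvg_ex[l ul].
  suff -> : v t = l by [].
  have ult : (u n t)%:E @[n --> \oo] --> l%:E by apply: cvg_EFin ul; exact: nearW.
  by rewrite /v is_cvg_limn_esupE; [rewrite (cvg_lim _ ult)|apply/cvg_ex; exists l%:E].
have bnd n : (\int[mu]_t ((v t - u n t) ^+ 2)%:E <= (4^-1 ^+ n)%:E)%E.
  pose f m t := ((u (m + n)%N t - u n t) ^+ 2)%:E.
  have mf m : measurable_fun setT (f m).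
    by apply/measurable_EFinP; apply: measurable_funX; exact: measurable_funB.
  have f0 m t : setT t -> (0 <= f m t)%E by rewrite lee_fin sqr_ge0.
  rewrite (@ae_eq_integral _ _ _ mu setT (fun t => limn_einf (f^~ t)))//.
  - apply: le_trans (fatou mu measurableT mf f0) _.
    rewrite limn_einf_lim; apply: lime_le; first exact: is_cvg_einfs.
    apply: nearW => m; apply: (@le_trans _ _ (\int[mu]_t f m t)%E).
      by apply: ereal_inf_lbound; exists m => /=.
    by apply: u_fast; exact: leq_addl.
  - by apply/measurable_EFinP; apply: measurable_funX; exact: measurable_funB.
  - rewrite /limn_einf; apply: measurableT_comp => //.
    by apply: measurable_fun_limn_esup => m; exact: measurableT_comp.
  apply: filterS uv => t ut _.
  have h : f m t @[m --> \oo] --> ((v t - u n t) ^+ 2)%:E.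
    apply: cvg_EFin; first exact: nearW.
    have ut' : u (m + n)%N t - u n t @[m --> \oo] --> v t - u n t.
      by apply: cvgB; [rewrite (cvg_shiftn n (fun k => u k t))|exact: cvg_cst].
    exact: (cvgM ut' ut').
  rewrite is_cvg_limn_einfE; first by rewrite (cvg_lim _ h).
  by apply/cvg_ex; exists ((v t - u n t) ^+ 2)%:E.
exists v; split=> //.
have vu : (fun t => v t - u 0%N t) \in Lfun mu 2%:E.
  apply/Lfun2P; split; first exact: measurable_funB.
  by apply: le_lt_trans (bnd 0%N) _; rewrite ltry.
have -> : v = (fun t => 1 * (v t - u 0%N t) + u 0%N t).
  by apply/funext => t; rewrite mul1r subrK.
exact: Lfun2_lin.
Qed.

End RieszFischer.

(** * Complex-valued functions on the circle *)

Section L2.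
Variable R : realType.
Local Notation C := R[i].
Local Notation mu := (circle_measure R).
Implicit Types x y f g : circle R -> C.

Local Notation reP x := (fun z => complex.Re (x z)).
Local Notation imP x := (fun z => complex.Im (x z)).

Lemma ReD (a b : C) : complex.Re (a + b) = complex.Re a + complex.Re b.
Proof. by case: a b => ? ? []. Qed.
Lemma ImD (a b : C) : complex.Im (a + b) = complex.Im a + complex.Im b.
Proof. by case: a b => ? ? []. Qed.
Lemma ReM (a b : C) : complex.Re (a * b) =
  complex.Re a * complex.Re b - complex.Im a * complex.Im b.
Proof. by case: a b => ? ? []. Qed.
Lemma ImM (a b : C) : complex.Im (a * b) =
  complex.Re a * complex.Im b + complex.Im a * complex.Re b.
Proof. by case: a b => ? ? []. Qed.
Lemma Re_conj (a : C) : complex.Re (a^*) = complex.Re a. Proof. by case: a. Qed.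
Lemma Im_conj (a : C) : complex.Im (a^*) = - complex.Im a. Proof. by case: a. Qed.

Lemma sqr_normc_Re_Im (z : C) :
  Normc.normc z ^+ 2 = complex.Re z ^+ 2 + complex.Im z ^+ 2.
Proof. by case: z => a b /=; rewrite sqr_sqrtr// addr_ge0// sqr_ge0. Qed.

Lemma normc_nonneg (z : C) : 0 <= Normc.normc z.
Proof. by case: z => a b /=; rewrite sqrtr_ge0. Qed.

Lemma ler_Re_normc (z : C) : `|complex.Re z| <= Normc.normc z.
Proof. by case: z => a b /=; rewrite -sqrtr_sqr ler_wsqrtr// lerDl sqr_ge0. Qed.

Lemma ler_Im_normc (z : C) : `|complex.Im z| <= Normc.normc z.
Proof. by case: z => a b /=; rewrite -sqrtr_sqr ler_wsqrtr// lerDr sqr_ge0. Qed.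

Lemma measurable_normc x : measurable_fun setT (reP x) -> measurable_fun setT (imP x) ->
  measurable_fun setT (fun z => Normc.normc (x z)).
Proof.
move=> mr mi; rewrite (_ : (fun z => _) =
  (fun z => Num.sqrt (complex.Re (x z) ^+ 2 + complex.Im (x z) ^+ 2))); last first.
  by apply/funext => z; case: (x z).
apply: measurableT_comp => //; first by apply: continuous_measurable_fun; exact: sqrt_continuous.
by apply: measurable_funD; exact: measurable_funX.
Qed.

Lemma L2_normc x : L2 x -> (fun z => Normc.normc (x z)) \in Lfun mu 2%:E.
Proof.
by move=> [mr mi nx]; rewrite inE; apply/andP; split; rewrite inE//=; exact: measurable_normc.
Qed.

Lemma L2P x : L2 x <-> reP x \in Lfun mu 2%:E /\ imP x \in Lfun mu 2%:E.
Proof.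
split=> [xL|[xr xi]].
  have [mr mi _] := xL.
  split; apply: Lfun2_dominated (L2_normc xL) _ => //; apply/nearW => z;
    by rewrite [leRHS]ger0_norm ?normc_nonneg ?ler_Re_normc ?ler_Im_normc.
have [mr roo] := (Lfun2P _ _).1 xr; have [mi ioo] := (Lfun2P _ _).1 xi.
split=> //; suff : (fun z => Normc.normc (x z)) \in Lfun mu 2%:E.
  by rewrite inE => /andP[_]; rewrite inE.
apply/Lfun2P; split; first exact: measurable_normc.
under eq_integral do rewrite sqr_normc_Re_Im EFinD.
rewrite ge0_integralD//; first by rewrite lte_add_pinfty.
- by move=> t _; rewrite lee_fin sqr_ge0.
- by apply/measurable_EFinP; exact: measurable_funX.
- by move=> t _; rewrite lee_fin sqr_ge0.
- by apply/measurable_EFinP; exact: measurable_funX.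
Qed.

Lemma Linfty_bounded f : Linfty f -> exists M : R, \forall z \ae mu, Normc.normc (f z) <= M.
Proof.
have mu1 : (0 < mu setT)%E by rewrite (@probability_setT _ _ _ mu) lte01.
move=> [_ _]; rewrite /finite_norm unlock /Lnorm.
case: ifPn => [_|/negP[]]; last exact: mu1.
move=> /ess_supr_bounded[M fM]; exists M; apply: filterS fM => z /=.
by rewrite ger0_norm ?normc_nonneg.
Qed.

Lemma L2M f x : Linfty f -> L2 x -> L2 (f \* x).
Proof.
move=> fL xL; have [M fM] := Linfty_bounded fL.
have [mfr mfi _] := fL; have [mxr mxi _] := xL.
have gL : (fun z => M * Normc.normc (x z)) \in Lfun mu 2%:E.
  rewrite (_ : (fun z => _) = M \o* (fun z => Normc.normc (x z))).
    by apply: Lfun_scale; [rewrite ler1n|exact: L2_normc].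
  by apply/funext => z /=; rewrite mulrC.
have mulP : \forall z \ae mu, Normc.normc (f z * x z) <= `|M * Normc.normc (x z)|.
  apply: filterS fM => z fzM; rewrite Normc.normcM (le_trans _ (ler_norm _))//.
  by rewrite ler_wpM2r// normc_nonneg.
have reM z := ReM (f z) (x z); have imM z := ImM (f z) (x z).
apply/L2P; split; apply: Lfun2_dominated gL _.
- by rewrite (funext reM); apply: measurable_funB; exact: measurable_funM.
- by apply: filterS mulP => z; apply: le_trans; exact: ler_Re_normc.
- by rewrite (funext imM); apply: measurable_funD; exact: measurable_funM.
- by apply: filterS mulP => z; apply: le_trans; exact: ler_Im_normc.
Qed.

End L2.

Section ComplexIntegral.
Variable R : realType.
Local Notation C := R[i].
Local Notation mu := (circle_measure R).
Implicit Types x y f g : circle R -> C.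

Local Notation reP x := (fun z => complex.Re (x z)).
Local Notation imP x := (fun z => complex.Im (x z)).

Definition cintegrable x :=
  mu.-integrable setT (EFin \o reP x) /\ mu.-integrable setT (EFin \o imP x).

Let integrable_lin2 (a b : R) (u v : circle R -> R) :
  mu.-integrable setT (EFin \o u) -> mu.-integrable setT (EFin \o v) ->
  mu.-integrable setT (EFin \o (fun z => a * u z + b * v z)).
Proof.
move=> iu iv.
have -> : EFin \o (fun z => a * u z + b * v z) =
    ((fun z => a%:E * (EFin \o u) z) \+ (fun z => b%:E * (EFin \o v) z))%E by [].
by apply: integrableD => //; exact: integrableZl.
Qed.

Let Rintegral_lin2 (a b : R) (u v : circle R -> R) :
  mu.-integrable setT (EFin \o u) -> mu.-integrable setT (EFin \o v) ->
  (\int[mu]_z (a * u z + b * v z) = a * \int[mu]_z u z + b * \int[mu]_z v z)%R.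
Proof.
move=> iu iv; rewrite RintegralD//; last 2 first.
- by have := integrableZl measurableT a iu.
- by have := integrableZl measurableT b iv.
by rewrite !RintegralZl.
Qed.

Lemma cintegralD x y : cintegrable x -> cintegrable y ->
  cintegral (fun z => x z + y z) = cintegral x + cintegral y.
Proof.
move=> [xr xi] [yr yi]; rewrite /cintegral.
under eq_Rintegral do rewrite ReD.
under [in X in _ +i* X]eq_Rintegral do rewrite ImD.
by rewrite !RintegralD.
Qed.

Lemma cintegralZ (a : C) x : cintegrable x ->
  cintegral (fun z => a * x z) = a * cintegral x.
Proof.
move=> [xr xi]; rewrite /cintegral.
under eq_Rintegral do rewrite ReM -mulNr.
under [in X in _ +i* X]eq_Rintegral do rewrite ImM.
rewrite !Rintegral_lin2//; case: a => a b /=.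
by apply/eqP; rewrite eq_complex /= mulNr !eqxx.
Qed.

Lemma cintegral_conj x : cintegrable x ->
  cintegral (fun z => (x z)^*) = (cintegral x)^*.
Proof.
move=> [xr xi]; rewrite /cintegral /=; congr Complex.
  by apply: eq_Rintegral => z _; rewrite Re_conj.
under eq_Rintegral do rewrite Im_conj -mulN1r.
by rewrite RintegralZl// mulN1r.
Qed.

Lemma cintegral_ae x y : cintegrable x -> cintegrable y ->
  (\forall z \ae mu, x z = y z) -> cintegral x = cintegral y.
Proof.
move=> [xr xi] [yr yi] xy; rewrite /cintegral /Rintegral; congr Complex; congr fine.
- apply: ae_eq_integral => //; first exact: (measurable_int mu).
    exact: (measurable_int mu).
  by apply: filterS xy => z /= -> _.
- apply: ae_eq_integral => //; first exact: (measurable_int mu).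
    exact: (measurable_int mu).
  by apply: filterS xy => z /= -> _.
Qed.

Lemma L2_mulC_integrable x y : L2 x -> L2 y -> cintegrable (fun z => x z * (y z)^*).
Proof.
move=> /L2P[xr xi] /L2P[yr yi]; split.
- have := integrable_lin2 1 1 (Lfun2_mul_integrable xr yr) (Lfun2_mul_integrable xi yi).
  by apply: eq_integrable => // z _ /=; rewrite ReM Re_conj Im_conj !mul1r mulrN opprK.
- have := integrable_lin2 (-1) 1 (Lfun2_mul_integrable xr yi) (Lfun2_mul_integrable xi yr).
  by apply: eq_integrable => // z _ /=; rewrite ImM Re_conj Im_conj mulN1r mul1r mulrN.
Qed.

Lemma L2_submod_closed : submod_closed (mem (@L2 R : set (circle R -> R[i]^o))).
Proof.
split.
  rewrite inE; apply/L2P; split; rewrite -[X in X \in _]/(cst 0); exact: Lfun_cst.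
move=> a x y; rewrite !inE => /L2P[xr xi] /L2P[yr yi]; apply/L2P; split.
- rewrite (_ : (fun z => _) = (fun z => complex.Re a * complex.Re (x z) +
      (- complex.Im a * complex.Im (x z) + complex.Re (y z)))).
    by do 2 apply: Lfun2_lin => //.
  by apply/funext => z; rewrite /= ReD ReM mulNr addrA.
- rewrite (_ : (fun z => _) = (fun z => complex.Re a * complex.Im (x z) +
      (complex.Im a * complex.Re (x z) + complex.Im (y z)))).
    by do 2 apply: Lfun2_lin => //.
  by apply/funext => z; rewrite /= ImD ImM addrA.
Qed.

End ComplexIntegral.

(** * The inner product space L^2 of the circle *)

Section L2Type.
Variable R : realType.

Definition L2pred : {pred (circle R -> R[i]^o)} := mem (@L2 R : set (circle R -> R[i]^o)).
HB.instance Definition _ := GRing.isSubmodClosed.Build _ _ L2pred (@L2_submod_closed R).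

(** The values are taken in the regular module R[i]^o, so that the functions form
    a module over the complex numbers, and L2T a submodule of it. Vectors that
    agree almost everywhere are not identified: two of them are
    indistinguishable for the inner product. *)
Record L2T := MkL2 { L2val :> circle R -> R[i]^o ; L2valP : L2val \in L2pred }.
HB.instance Definition _ := [isSub for L2val].
HB.instance Definition _ := [Choice of L2T by <:].
HB.instance Definition _ := [SubChoice_isSubLmodule of L2T by <:].
End L2Type.

(** Locked, like the operators below, to keep the pointwise definitions out of
    the linear algebra. *)
HB.lock Definition ip (R : realType) (x y : L2T R) : R[i] := inner x y.

Section InnerProduct.
Variable R : realType.
Local Notation C := R[i].
Local Notation mu := (circle_measure R).
Implicit Types x y u v : L2T R.

Lemma L2TP x : L2 (x : circle R -> C).
Proof. exact: set_mem (L2valP x). Qed.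

Lemma L2T_of (x : circle R -> C) : L2 x -> {y : L2T R | L2val y = x}.
Proof. by move=> xL; exists (MkL2 (mem_set xL : x \in @L2pred R)). Qed.

Let ip_integrable x y : cintegrable (fun z => x z * (y z)^*).
Proof. by apply: L2_mulC_integrable; exact: L2TP. Qed.

(** The only way in which pointwise information enters the inner product. *)
Lemma ip_ae x x' y y' : (\forall z \ae mu, x z * (y z)^* = x' z * (y' z)^*) ->
  ip x y = ip x' y'.
Proof. by rewrite unlock; exact: cintegral_ae. Qed.

Lemma ipDl x y u : ip (x + y) u = ip x u + ip y u.
Proof.
rewrite unlock /inner -cintegralD//; congr cintegral.
by apply/funext => z; rewrite -mulrDl.
Qed.

Lemma ipZl (a : C) x u : ip (a *: x) u = a * ip x u.
Proof.
rewrite unlock /inner -cintegralZ//; congr cintegral.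
by apply/funext => z; rewrite mulrA.
Qed.

Lemma ipC x y : ip y x = (ip x y)^*.
Proof.
rewrite unlock /inner -cintegral_conj//; congr cintegral.
by apply/funext => z; rewrite rmorphM /= conjCK mulrC.
Qed.

Lemma ip0l u : ip 0 u = 0.
Proof. by rewrite -[X in ip X _](scale0r (0 : L2T R)) ipZl mul0r. Qed.
Lemma ipNl x u : ip (- x) u = - ip x u.
Proof. by rewrite -scaleN1r ipZl mulN1r. Qed.
Lemma ipBl x y u : ip (x - y) u = ip x u - ip y u.
Proof. by rewrite ipDl ipNl. Qed.
Lemma ipDr x y u : ip u (x + y) = ip u x + ip u y.
Proof. by rewrite ipC ipDl rmorphD /= -!ipC. Qed.
Lemma ipNr x u : ip u (- x) = - ip u x.
Proof. by rewrite ipC ipNl rmorphN /= -!ipC. Qed.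
Lemma ipBr x y u : ip u (x - y) = ip u x - ip u y.
Proof. by rewrite ipDr ipNr. Qed.
Lemma ipZr (a : C) x u : ip u (a *: x) = a^* * ip u x.
Proof. by rewrite ipC ipZl rmorphM /= -!ipC. Qed.

Definition sqnorm x : R := complex.Re (ip x x).

Let int_sq x : mu.-integrable setT (EFin \o (fun z => complex.Re (x z) ^+ 2)) /\
  mu.-integrable setT (EFin \o (fun z => complex.Im (x z) ^+ 2)).
Proof.
have /L2P[xr xi] := L2TP x.
by split; [have := Lfun2_mul_integrable xr xr|have := Lfun2_mul_integrable xi xi].
Qed.

Lemma sqnormE x : ((sqnorm x)%:E = \int[mu]_z (complex.Re (x z) ^+ 2)%:E +
  \int[mu]_z (complex.Im (x z) ^+ 2)%:E)%E.
Proof.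
have [ir ii] := int_sq x.
rewrite /sqnorm unlock /inner /cintegral /=.
under eq_Rintegral do rewrite ReM Re_conj Im_conj mulrN opprK.
rewrite RintegralD// EFinD /Rintegral !fineK//.
- exact: (integrable_fin_num measurableT ii).
- exact: (integrable_fin_num measurableT ir).
Qed.

Lemma ipxx x : ip x x = (sqnorm x)%:C.
Proof.
suff h : complex.Im (ip x x) = 0 by rewrite /sqnorm; case: (ip x x) h => a b /= ->.
have /eqP := congr1 (@complex.Im R) (ipC x x).
by rewrite Im_conj -addr_eq0 -mulr2n mulrn_eq0 => /eqP.
Qed.

Lemma sqnorm_ge0 x : 0 <= sqnorm x.
Proof.
by rewrite -lee_fin sqnormE adde_ge0//; apply: integral_ge0 => z _; rewrite lee_fin sqr_ge0.
Qed.

Lemma sqnorm_eq0 x : sqnorm x = 0 -> \forall z \ae mu, x z = 0.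
Proof.
have [ir ii] := int_sq x.
move=> x0; have : (sqnorm x)%:E = 0%E by rewrite x0.
rewrite sqnormE => /eqP.
rewrite padde_eq0; [|by apply: integral_ge0 => z _; rewrite lee_fin sqr_ge0..].
move=> /andP[/eqP r0 /eqP i0].
have rae : ae_eq mu setT (EFin \o (fun z => complex.Re (x z) ^+ 2)) (cst 0%E).
  apply/(ae_eq_integral_abs mu measurableT (measurable_int mu ir)).
  by rewrite -[RHS]r0; apply: eq_integral => z _ /=; rewrite ger0_norm ?sqr_ge0.
have iae : ae_eq mu setT (EFin \o (fun z => complex.Im (x z) ^+ 2)) (cst 0%E).
  apply/(ae_eq_integral_abs mu measurableT (measurable_int mu ii)).
  by rewrite -[RHS]i0; apply: eq_integral => z _ /=; rewrite ger0_norm ?sqr_ge0.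
apply: filterS2 rae iae => z /(_ I) /= [] /eqP + /(_ I) [] /eqP.
rewrite !sqrf_eq0 => /eqP ? /eqP ?; apply/eqP; rewrite eq_complex.
by apply/andP; split; apply/eqP.
Qed.

Lemma ip_null x y : sqnorm x = 0 -> ip x y = 0.
Proof.
move=> /sqnorm_eq0 x0; rewrite -(ip0l y); apply: ip_ae.
by apply: filterS x0 => z ->; rewrite !mul0r.
Qed.

Lemma mulcJ (a : C) : a * a^* = (Normc.normc a ^+ 2)%:C.
Proof.
rewrite sqr_normc_Re_Im; case: a => a b /=; apply/eqP; rewrite eq_complex /=.
by apply/andP; split; apply/eqP; ring.
Qed.

(** Removing from x its component along y; nonnegativity of the left-hand side is
    the Cauchy-Schwarz inequality, and its minimality over a subspace is what
    makes the residual of a nearest point orthogonal to the subspace. *)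
Lemma sqnorm_residual x y : sqnorm y != 0 ->
  sqnorm (x - (ip x y / ip y y) *: y) = sqnorm x - Normc.normc (ip x y) ^+ 2 / sqnorm y.
Proof.
move=> y0; apply: (@complexI R); rewrite rmorphB rmorphM /= fmorphV -!ipxx -mulcJ.
have yy0 : ip y y != 0 by rewrite ipxx; apply: contra y0 => /eqP/(@complexI R)->.
rewrite !(ipBl, ipBr, ipZl, ipZr) rmorphM fmorphV /= -(ipC y y) (ipC x y) -ipxx.
by field.
Qed.

Lemma cauchy_schwarz x y : Normc.normc (ip x y) ^+ 2 <= sqnorm x * sqnorm y.
Proof.
have [y0|y0] := eqVneq (sqnorm y) 0.
  by rewrite y0 mulr0 ipC (ip_null _ y0) conjC0 Normc.normc0 expr0n.
have yp : 0 < sqnorm y by rewrite lt_def y0 sqnorm_ge0.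
have := sqnorm_ge0 (x - (ip x y / ip y y) *: y); rewrite sqnorm_residual//.
by rewrite subr_ge0 ler_pdivrMr.
Qed.

Lemma parallelogram x y : sqnorm (x + y) + sqnorm (x - y) = 2 * sqnorm x + 2 * sqnorm y.
Proof.
apply: (@complexI R); rewrite !rmorphD /= !rmorphM /= rmorph_nat -!ipxx.
by rewrite !(ipDl, ipDr, ipBl, ipBr, ipNl, ipNr); ring.
Qed.

Lemma sqnormZ (a : C) x : sqnorm (a *: x) = Normc.normc a ^+ 2 * sqnorm x.
Proof. by apply: (@complexI R); rewrite rmorphM /= -!ipxx -mulcJ ipZl ipZr mulrA. Qed.

Lemma sqnorm_sub_sym x y : sqnorm (x - y) = sqnorm (y - x).
Proof. by apply: (@complexI R); rewrite -!ipxx !(ipBl, ipBr); ring. Qed.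

Lemma ReB x y z : complex.Re ((x - y) z) = complex.Re (x z) - complex.Re (y z).
Proof. by rewrite -[(x - y) z]/(x z - y z); case: (x z) (y z) => ? ? []. Qed.

Lemma ImB x y z : complex.Im ((x - y) z) = complex.Im (x z) - complex.Im (y z).
Proof. by rewrite -[(x - y) z]/(x z - y z); case: (x z) (y z) => ? ? []. Qed.

Lemma sqnormBE x y : ((sqnorm (x - y))%:E =
  \int[mu]_z ((complex.Re (x z) - complex.Re (y z)) ^+ 2)%:E +
  \int[mu]_z ((complex.Im (x z) - complex.Im (y z)) ^+ 2)%:E)%E.
Proof.
by rewrite sqnormE; congr (_ + _)%E; apply: eq_integral => z _; rewrite ?ReB ?ImB.
Qed.

Lemma L2T_complete (u : nat -> L2T R) :
  (forall n m, (n <= m)%N -> sqnorm (u m - u n) <= 4^-1 ^+ n) ->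
  exists v, forall n, sqnorm (v - u n) <= 2 * 4^-1 ^+ n.
Proof.
move=> uc.
have uP n := (L2P _).1 (L2TP (u n)).
have [a [aL ac]] : exists a, a \in Lfun mu 2%:E /\ forall n,
    (\int[mu]_z ((a z - complex.Re (u n z)) ^+ 2)%:E <= (4^-1 ^+ n)%:E)%E.
  apply: (Lfun2_complete (u := fun n z => complex.Re (u n z))) => [n|n m nm].
    by have [] := uP n.
  apply: le_trans (_ : (sqnorm (u m - u n))%:E <= _)%E; last by rewrite lee_fin uc.
  by rewrite sqnormBE leeDl//; apply: integral_ge0 => z _; rewrite lee_fin sqr_ge0.
have [b [bL bc]] : exists b, b \in Lfun mu 2%:E /\ forall n,
    (\int[mu]_z ((b z - complex.Im (u n z)) ^+ 2)%:E <= (4^-1 ^+ n)%:E)%E.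
  apply: (Lfun2_complete (u := fun n z => complex.Im (u n z))) => [n|n m nm].
    by have [] := uP n.
  apply: le_trans (_ : (sqnorm (u m - u n))%:E <= _)%E; last by rewrite lee_fin uc.
  by rewrite sqnormBE leeDr//; apply: integral_ge0 => z _; rewrite lee_fin sqr_ge0.
have vL : L2 (fun z => a z +i* b z) by apply/L2P.
have [v vE] := L2T_of vL; exists v => n.
by rewrite -lee_fin sqnormBE vE mulrDl mul1r EFinD; apply: leeD.
Qed.

End InnerProduct.

(** * Orthogonal projection onto a closed subspace *)

Section Projection.
Variable R : realType.
Local Notation C := R[i].
Implicit Types x y h v : L2T R.

Variable H : set (L2T R).
Hypothesis H0 : H 0.
Hypothesis H_lin : forall (a : C) x y, H x -> H y -> H (a *: x + y).
Hypothesis H_closed : forall v (h : nat -> L2T R), (forall n, H (h n)) ->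
  (forall n, sqnorm (v - h n) <= 2 * 4^-1 ^+ n) -> H v.

Lemma le_geometric_eq0 (a K : R) : 0 <= a -> (forall n, a <= K * 4^-1 ^+ n) -> a = 0.
Proof.
move=> a0 aK; apply/eqP; rewrite eq_le a0 andbT.
have : (fun n => K * 4^-1 ^+ n) @ \oo --> K * 0.
  apply: cvgM; first exact: cvg_cst.
  have := @cvg_geometric R 1 4^-1; rewrite ger0_norm// invf_lt1// ltr1n => /(_ isT).
  have -> // : geometric 1 4^-1 = (fun n => 4^-1 ^+ n : R).
  by apply/funext => n /=; rewrite mul1r.
rewrite mulr0 => cv.
by apply: (cvgr_to_ge cv); apply: nearW => n; exact: aK.
Qed.

Lemma sqr_normcD_le (a b : C) :
  Normc.normc (a + b) ^+ 2 <= 2 * Normc.normc a ^+ 2 + 2 * Normc.normc b ^+ 2.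
Proof.
rewrite !sqr_normc_Re_Im ReD ImD -subr_ge0.
rewrite (_ : _ - _ = (complex.Re a - complex.Re b) ^+ 2 +
  (complex.Im a - complex.Im b) ^+ 2); last by ring.
by rewrite addr_ge0 ?sqr_ge0.
Qed.

(** The projection theorem. By the parallelogram law a minimizing sequence for the
    distance from x to H is Cauchy; x - u n is orthogonal to H up to the defect
    of minimality eps n, so the difference of x and the limit is orthogonal to H. *)
Lemma orthogonal_projection x : exists v, H v /\ forall h, H h -> ip (x - v) h = 0.
Proof.
have HZ (a : C) y : H y -> H (a *: y) by move=> Hy; rewrite -[_ *: _]addr0; exact: H_lin.
pose D : set R := [set sqnorm (x - h) | h in H].
pose delta := inf D.
have Dinf : has_inf D.
  split; first by exists (sqnorm (x - 0)), 0.
  by exists 0 => _ [h _ <-]; exact: sqnorm_ge0.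
have delta_le h : H h -> delta <= sqnorm (x - h).
  by move=> Hh; apply: ge_inf; [case: Dinf|exists h].
(* The factor 1/4 absorbs the constant 4 that the parallelogram law produces. *)
pose eps n : R := 4^-1 * 4^-1 ^+ n.
have eps_gt0 n : 0 < eps n by rewrite mulr_gt0 ?invr_gt0 ?exprn_gt0 ?invr_gt0.
have /choice[u uP] n : exists h, H h /\ sqnorm (x - h) < delta + eps n.
  by have [_ [h Hh <-] lt] := inf_adherent (eps_gt0 n) Dinf; exists h.
have eps_le n m : (n <= m)%N -> eps m <= eps n.
  by move=> nm; rewrite ler_pM2l ?invr_gt0// ler_wiXn2l// ?invr_ge0// invf_le1 ?ler1n.
have [v vu] : exists v, forall n, sqnorm (v - u n) <= 2 * 4^-1 ^+ n.
  apply: L2T_complete => n m nm.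
  have := parallelogram (x - u n) (x - u m).
  rewrite [x - u n - _](_ : _ = u m - u n); last by rewrite opprB addrC addrA subrK.
  rewrite [_ - _ + _](_ : _ = (2 : C) *: (x - (2^-1 : C) *: (u n + u m))); last first.
    rewrite scalerBr scalerA mulfV ?pnatr_eq0// scale1r scaler_nat mulr2n opprD.
    by rewrite addrACA.
  rewrite sqnormZ.
  have -> : Normc.normc (2 : C) ^+ 2 = 4 :> R.
    by rewrite sqr_normc_Re_Im /= addr0 expr0n/= addr0; ring.
  have := delta_le ((2^-1 : C) *: (u n + u m)) (HZ _ _ _).
  have Hnm : H (u n + u m).
    by rewrite -[u n]scale1r; apply: H_lin; case: (uP n) (uP m) => ? _ [].
  move=> /(_ Hnm).
  have [_ un] := uP n; have [_ um] := uP m; have := eps_le _ _ nm.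
  have : 4^-1 ^+ n = 4 * eps n by rewrite /eps mulrA mulfV ?mul1r.
  by lra.
exists v; split; first by apply: (H_closed (h := u)) => // n; case: (uP n).
move=> h Hh.
have key n : Normc.normc (ip (x - u n) h) ^+ 2 <= eps n * sqnorm h.
  have [h0|h0] := eqVneq (sqnorm h) 0.
    by rewrite h0 mulr0 ipC (ip_null _ h0) conjC0 Normc.normc0 expr0n.
  have hp : 0 < sqnorm h by rewrite lt_def h0 sqnorm_ge0.
  have [Hun un] := uP n.
  have := delta_le (u n + (ip (x - u n) h / ip h h) *: h) _.
  rewrite addrC => /(_ (H_lin _ Hh Hun)).
  rewrite [_ *: _ + _]addrC opprD addrA sqnorm_residual// => le1.
  by rewrite -ler_pdivrMr//; lra.
apply: Normc.eq0_normc; apply/eqP; rewrite -sqrf_eq0; apply/eqP.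
apply: (@le_geometric_eq0 _ (5 * sqnorm h)); first exact: sqr_ge0.
move=> n; rewrite (_ : x - v = (x - u n) + (u n - v)); last by rewrite addrA subrK.
rewrite ipDl; apply: le_trans (sqr_normcD_le _ _) _.
have := cauchy_schwarz (u n - v) h; rewrite sqnorm_sub_sym => cs.
have := ler_wpM2r (sqnorm_ge0 h) (vu n) => vh.
have := key n; rewrite /eps.
move: vh cs (sqnorm_ge0 h); set p := 4^-1 ^+ n.
have : 0 <= p by rewrite exprn_ge0// invr_ge0.
move: p (sqnorm h) (sqnorm (v - u n)) (Normc.normc _ ^+ 2) (Normc.normc _ ^+ 2).
move=> p s t a b p0 vh cs s0 k.
have : 0 <= p * s by rewrite mulr_ge0.
by lra.
Qed.

End Projection.

(** * Powers of the coordinate function *)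

Section CirclePowers.
Variable R : realType.
Local Notation C := R[i].
Local Notation mu := (circle_measure R).

(** Integrating 1 + s instead of s keeps the integrand nonnegative, so that no
    integrability has to be known in order to pass from the uniform law to the
    Lebesgue integral over [0, 2 pi]. *)
Lemma uniform_mean_derivative (S s : R -> R) :
  (forall t : R, is_derive t 1 S (s t)) -> continuous s -> (forall t, -1 <= s t) ->
  S (2 * pi) = S 0 ->
  (\int[uniform_prob (twopi_gt0 R)]_t (1 + s t)%:E = 1)%E.
Proof.
move=> dS cs s1 S2pi.
have c1s : continuous (fun t => 1 + s t).
  by move=> t; apply: cvgD; [exact: cvg_cst|exact: cs].
have dF (t : R) : is_derive t 1 (fun t => t + S t) (1 + s t).
  by apply: is_deriveD.
have F' : continuous (fun t => t + S t).
  by move=> t; apply: differentiable_continuous; apply/derivable1_diffP; exact: ex_derive.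
rewrite integral_uniform; last 2 first.
- by apply/measurable_EFinP; exact: continuous_measurable_fun.
- by move=> t; rewrite lee_fin -lerBlDl sub0r.
rewrite (@continuous_FTC2 _ _ (fun t => t + S t)); last 4 first.
- exact: twopi_gt0.
- exact: continuous_subspaceT.
- split=> [t _||]; first exact: ex_derive.
  + by apply: cvg_at_right_filter; exact: F'.
  + by apply: cvg_at_left_filter; exact: F'.
- by move=> t _; rewrite derive1E; exact: derive_val.
rewrite -EFinB -EFinM S2pi subr0 add0r addrK mulVf//.
by rewrite gt_eqF// twopi_gt0.
Qed.

Lemma circle_mean0 (u : circle R -> R) (S s : R -> R) :
  measurable_fun setT u -> (forall z, `|u z| <= 1) -> (forall t, u (cis t) = s t) ->
  (forall t : R, is_derive t 1 S (s t)) -> continuous s -> S (2 * pi) = S 0 ->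
  (\int[mu]_z u z)%R = 0.
Proof.
move=> mu_ u1 us dS cs S2pi.
have iu : mu.-integrable setT (EFin \o u).
  apply: (@le_integrable _ _ _ mu _ measurableT _ (EFin \o cst 1)).
  - exact/measurable_EFinP.
  - by move=> z _ /=; rewrite lee_fin normr1.
  - exact: finite_measure_integrable_cst.
have i1 : mu.-integrable setT (EFin \o cst (1 : R)) by exact: finite_measure_integrable_cst.
have : (\int[mu]_z (1 + u z)%:E = 1)%E.
  rewrite [LHS]ge0_integral_pushforward//=.
  - rewrite preimage_setT; under eq_integral do rewrite us.
    apply: uniform_mean_derivative dS cs _ S2pi => t.
    by have := u1 (cis t); rewrite us ler_norml => /andP[].
  - by apply/measurable_EFinP; exact: measurable_funD.
  - by move=> z _; rewrite lee_fin -lerBlDl sub0r; have := u1 z; rewrite ler_norml => /andP[].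
move=> /(congr1 fine); rewrite -[LHS]/(\int[mu]_z (1 + u z))%R RintegralD//.
have -> : (\int[mu]_z (1 : R) = 1)%R.
  by rewrite Rintegral_cst// mul1r [X in fine X](_ : _ = 1%E)//; exact: probability_setT.
by move=> /= /eqP; rewrite -subr_eq0 addrC addKr => /eqP.
Qed.

Lemma circle_norm (z : circle R) : `|val z| = 1 :> C.
Proof. exact/eqP/(valP z). Qed.

Lemma circle_inv (z : circle R) : (val z)^-1 = (val z)^* :> C.
Proof. by rewrite invC_norm circle_norm expr1n invr1 mul1r. Qed.

Lemma measurable_circle_coord : measurable_fun setT (fun z : circle R => complex.Re (val z)) /\
  measurable_fun setT (fun z : circle R => complex.Im (val z)).
Proof.
have mc : measurable_fun setT (@unimodular_coord R : circle R -> R * R).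
  by move=> _ B mB; rewrite setTI; exists B => //; rewrite setTI.
by split; [have := measurableT_comp measurable_fst mc|have := measurableT_comp measurable_snd mc].
Qed.

Lemma measurable_circle_exp (m : nat) :
  measurable_fun setT (fun z : circle R => complex.Re (val z ^+ m)) /\
  measurable_fun setT (fun z : circle R => complex.Im (val z ^+ m)).
Proof.
have [mr mi] := measurable_circle_coord.
elim: m => [|m [IHr IHi]].
  by split; under eq_fun do rewrite expr0; exact: measurable_cst.
split; under eq_fun do rewrite exprS ?ReM ?ImM.
  by apply: measurable_funB; exact: measurable_funM.
by apply: measurable_funD; exact: measurable_funM.
Qed.

Lemma circle_exp_negz (z : circle R) (m : nat) : val z ^ (- (m%:Z)) = (val z ^+ m)^*.
Proof. by rewrite -exprnN -exprVn circle_inv -rmorphXn. Qed.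

Lemma measurable_circle_pow (n : int) :
  measurable_fun setT (fun z : circle R => complex.Re (val z ^ n)) /\
  measurable_fun setT (fun z : circle R => complex.Im (val z ^ n)).
Proof.
case: (intP n) => [|m|m].
- exact: (measurable_circle_exp 0).
- exact: (measurable_circle_exp m.+1).
- have [mr mi] := measurable_circle_exp m.+1.
  split; under eq_fun do rewrite circle_exp_negz ?Re_conj ?Im_conj.
    exact: mr.
  exact: measurable_funN.
Qed.

Lemma circle_pow_norm (n : int) (z : circle R) : `|val z ^ n| = 1 :> C.
Proof.
case: (intP n) => [|m|m]; first by rewrite expr0z normr1.
  by rewrite -exprnP normrX circle_norm expr1n.
by rewrite circle_exp_negz norm_conjC normrX circle_norm expr1n.
Qed.

Lemma circle_pow_normc (n : int) (z : circle R) : Normc.normc (val z ^ n : C) = 1.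
Proof. by have /(congr1 (@complex.Re R)) := circle_pow_norm n z. Qed.

Lemma Linfty_of_bound (f : circle R -> C) (M : R) :
  measurable_fun setT (fun z => complex.Re (f z)) ->
  measurable_fun setT (fun z => complex.Im (f z)) ->
  (forall z, Normc.normc (f z) <= M) -> Linfty f.
Proof.
move=> mr mi fM; split=> //; rewrite /finite_norm unlock /Lnorm.
case: ifPn => [_|_]; last exact: ltry.
apply: (@le_lt_trans _ _ M%:E); last by rewrite ltry.
by apply/ess_supP; apply: nearW => z /=; rewrite ger0_norm ?normc_nonneg// lee_fin.
Qed.

Lemma Linfty_pow (n : int) : Linfty (fun z : circle R => val z ^ n).
Proof.
have [mr mi] := measurable_circle_pow n.
by apply: (Linfty_of_bound (M := 1)) => // z; rewrite circle_pow_normc.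
Qed.

Lemma Linfty_L2 (f : circle R -> C) : Linfty f -> L2 f.
Proof.
move=> fL; have := L2M fL (_ : L2 (fun=> 1)).
have -> : f \* (fun=> 1) = f by apply/funext => z /=; rewrite mulr1.
by apply; apply/L2P; split; exact: Lfun_cst.
Qed.

Lemma cis_exp (m : nat) (t : R) : val (cis t) ^+ m = cos (m%:R * t) +i* sin (m%:R * t).
Proof.
elim: m => [|m IH]; first by rewrite expr0 !mul0r cos0 sin0.
rewrite exprS IH -natr1 mulrDl mul1r cosD sinD /=.
by apply/eqP; rewrite eq_complex /=; apply/andP; split; apply/eqP; ring.
Qed.

(** Orthogonality of the constants to the positive powers of z: in the variable t
    of the parametrization these are cos (m t) and sin (m t), which have periodic
    primitives. *)
Lemma circle_exp_mean (m : nat) : (0 < m)%N -> cintegral (fun z : circle R => val z ^+ m) = 0.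
Proof.
move=> m0; have m0' : m%:R != 0 :> R by rewrite pnatr_eq0 -lt0n.
have [mr mi] := measurable_circle_exp m.
have n1 (z : circle R) : Normc.normc (val z ^+ m : C) = 1 by rewrite exprnP circle_pow_normc.
have dlin (t : R) : is_derive t 1 (fun t => m%:R * t) (m%:R : R).
  by apply: is_derive_eq; rewrite /GRing.scale /= mulr1.
have clin : continuous (fun t : R => m%:R * t).
  by move=> t; apply: cvgM; [exact: cvg_cst|exact: cvg_id].
have dsin (t : R) : is_derive t 1 (fun t => m%:R^-1 * sin (m%:R * t)) (cos (m%:R * t)).
  have := is_deriveZ m%:R^-1 (is_derive1_comp (is_derive_sin (m%:R * t)) (dlin t)).
  by rewrite /GRing.scale /= mulrCA mulVf// mulr1.
have dcos (t : R) : is_derive t 1 (fun t => - m%:R^-1 * cos (m%:R * t)) (sin (m%:R * t)).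
  have := is_deriveZ (- m%:R^-1) (is_derive1_comp (is_derive_cos (m%:R * t)) (dlin t)).
  by rewrite /GRing.scale /= mulNr mulrCA mulVf// mulr1 opprK.
have ccos : continuous (fun t : R => cos (m%:R * t)).
  by move=> t; apply: continuous_comp; [exact: clin|exact: continuous_cos].
have csin : continuous (fun t : R => sin (m%:R * t)).
  by move=> t; apply: continuous_comp; [exact: clin|exact: continuous_sin].
have mpi : m%:R * (2 * pi) = 0 + (pi *+ 2) *+ m :> R.
  by rewrite add0r mulr_natl mulr_natl.
rewrite /cintegral (circle_mean0 mr _ _ dsin ccos); last 3 first.
- by move=> z; rewrite -(n1 z) ler_Re_normc.
- by move=> t; rewrite cis_exp.
- by rewrite mpi (periodicn (@sinD2pi R)) mulr0 sin0.
rewrite (circle_mean0 mi _ _ dcos csin)//.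
- by move=> z; rewrite -(n1 z) ler_Im_normc.
- by move=> t; rewrite cis_exp.
- by rewrite mpi (periodicn (@cosD2pi R)) mulr0 cos0.
Qed.

End CirclePowers.

HB.lock Definition zpow (R : realType) (n : int) : L2T R :=
  MkL2 (mem_set (Linfty_L2 (Linfty_pow R n)) : _ \in @L2pred R).

Lemma zpowE (R : realType) (n : int) : zpow R n = (fun z : circle R => val z ^ n) :> (_ -> _).
Proof. by rewrite unlock. Qed.

(** * Multiplication operators and the Hardy projection *)

Lemma Linfty_conj (R : realType) (f : circle R -> R[i]) : Linfty f -> Linfty (fun z => (f z)^*).
Proof.
move=> [mr mi fn]; split.
- by under eq_fun do rewrite Re_conj.
- by under eq_fun do rewrite Im_conj; exact: measurable_funN.
- rewrite (_ : (fun z => _) = (fun z => Normc.normc (f z)))//.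
  by apply/funext => z; case: (f z) => a b /=; rewrite sqrrN.
Qed.

HB.lock Definition mulT (R : realType) (f : circle R -> R[i]) (hf : Linfty f)
    (x : L2T R) : L2T R :=
  MkL2 (mem_set (L2M hf (L2TP x)) : _ \in @L2pred R).

(** The bilateral shift and its inverse, multiplication by z and by 1/z. *)
HB.lock Definition shift (R : realType) (x : L2T R) : L2T R := mulT (Linfty_pow R 1) x.
HB.lock Definition unshift (R : realType) (x : L2T R) : L2T R := mulT (Linfty_pow R (-1)) x.

Section HardySpace.
Variable R : realType.
Local Notation C := R[i].
Local Notation mu := (circle_measure R).
Local Notation one := (zpow R 0).
Local Notation e := (zpow R (-1)).
Implicit Types (x y u v h : L2T R) (f g : circle R -> C).

Lemma L2T_ext x y : (forall z, x z = y z) -> x = y.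
Proof. by move=> xy; apply: val_inj; apply/funext. Qed.

Lemma mulTfE f (hf : Linfty f) x : mulT hf x = (fun z => f z * x z) :> (_ -> _).
Proof. by rewrite unlock. Qed.

Lemma mulTE f (hf : Linfty f) x z : mulT hf x z = f z * x z.
Proof. by rewrite unlock. Qed.

Lemma mulT_lin f (hf : Linfty f) (a : C) x y :
  mulT hf (a *: x + y) = a *: mulT hf x + mulT hf y.
Proof.
apply: L2T_ext => z.
rewrite mulTE -[RHS]/(a * mulT hf x z + mulT hf y z) !mulTE.
by rewrite -[(a *: x + y) z]/(a * x z + y z); ring.
Qed.

Lemma mulTD f (hf : Linfty f) x y : mulT hf (x + y) = mulT hf x + mulT hf y.
Proof. by have := mulT_lin hf 1 x y; rewrite !scale1r. Qed.

Lemma mulTB f (hf : Linfty f) x y : mulT hf (x - y) = mulT hf x - mulT hf y.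
Proof. by have := mulT_lin hf (-1) y x; rewrite !scaleN1r addrC => ->; rewrite addrC. Qed.

Lemma mulTZ f (hf : Linfty f) (a : C) x : mulT hf (a *: x) = a *: mulT hf x.
Proof.
apply: L2T_ext => z.
rewrite mulTE -[RHS]/(a * mulT hf x z) mulTE -[(a *: x) z]/(a * x z); ring.
Qed.

Lemma mulTC f g (hf : Linfty f) (hg : Linfty g) x : mulT hf (mulT hg x) = mulT hg (mulT hf x).
Proof. by apply: L2T_ext => z; rewrite /= !mulTE mulrCA. Qed.

Lemma ip_mulT f (hf : Linfty f) x y : ip (mulT hf x) y = ip x (mulT (Linfty_conj hf) y).
Proof.
apply: ip_ae; apply: nearW => z; rewrite !mulTE.
by rewrite rmorphM /= conjCK mulrCA mulrA.
Qed.

Lemma ip_mulTr f (hf : Linfty f) x y : ip x (mulT hf y) = ip (mulT (Linfty_conj hf) x) y.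
Proof. by rewrite ipC [RHS]ipC ip_mulT. Qed.

Lemma shiftD x y : shift (x + y) = shift x + shift y. Proof. by rewrite shift.unlock mulTD. Qed.
Lemma shiftB x y : shift (x - y) = shift x - shift y. Proof. by rewrite shift.unlock mulTB. Qed.
Lemma shiftZ a x : shift (a *: x) = a *: shift x. Proof. by rewrite shift.unlock mulTZ. Qed.

Lemma mulT_shift f (hf : Linfty f) x : mulT hf (shift x) = shift (mulT hf x).
Proof. by rewrite shift.unlock mulTC. Qed.

Lemma circle_neq0 (z : circle R) : val z != 0 :> C.
Proof. by rewrite -normr_eq0 circle_norm oner_eq0. Qed.

Lemma shiftK x : shift (unshift x) = x.
Proof.
apply: L2T_ext => z; rewrite shift.unlock unshift.unlock !mulTE.
by rewrite mulrA -expfzDr ?circle_neq0// mul1r.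
Qed.

Lemma ip_shift x y : ip (shift x) (shift y) = ip x y.
Proof.
apply: ip_ae; apply: nearW => z; rewrite shift.unlock !mulTE expr1z rmorphM /=.
by rewrite mulrACA -normCK circle_norm expr1n mul1r.
Qed.

Lemma shift_zpow n : shift (zpow R n) = zpow R (1 + n).
Proof.
by apply: L2T_ext => z; rewrite shift.unlock mulTE !zpowE expfzDr ?circle_neq0.
Qed.

Lemma one_shift : one = shift e.
Proof. by rewrite shift_zpow. Qed.

Lemma ip_one_shift x : ip one (shift x) = (ip x e)^*.
Proof. by rewrite one_shift ip_shift -ipC. Qed.

Lemma ip_zpow_diag n : ip (zpow R n) (zpow R n) = 1.
Proof.
rewrite ip.unlock /inner /cintegral !zpowE.
have zn1 (z : circle R) : val z ^ n * (val z ^ n)^* = 1 :> C.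
  by rewrite -normCK circle_pow_norm expr1n.
have -> : (fun z : circle R => complex.Re (val z ^ n * (val z ^ n)^*)) = cst 1.
  by apply/funext => z; rewrite zn1.
have -> : (fun z : circle R => complex.Im (val z ^ n * (val z ^ n)^*)) = cst 0.
  by apply/funext => z; rewrite zn1.
have m1 : fine (mu setT) = 1 by rewrite [X in fine X](_ : _ = 1%E)//; exact: probability_setT.
by rewrite !Rintegral_cst// m1 mul0r mul1r.
Qed.

Definition hardy x := forall n : int, n < 0 -> ip x (zpow R n) = 0.

Lemma H2E x : H2 (x : circle R -> C) <-> hardy x.
Proof.
split=> [[_ h] n n0|h]; first by have := h n n0; rewrite ip.unlock zpowE.
by split=> [|n n0]; [exact: L2TP|have := h n n0; rewrite ip.unlock zpowE].
Qed.

Lemma hardy0 : hardy 0.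
Proof. by move=> n _; exact: ip0l. Qed.

Lemma hardy_lin (a : C) x y : hardy x -> hardy y -> hardy (a *: x + y).
Proof. by move=> hx hy n n0; rewrite ipDl ipZl hx// hy// mulr0 addr0. Qed.

Lemma hardyD x y : hardy x -> hardy y -> hardy (x + y).
Proof. by move=> hx hy; rewrite -[x]scale1r; exact: hardy_lin. Qed.

Lemma hardyZ (a : C) x : hardy x -> hardy (a *: x).
Proof. by move=> hx; rewrite -[_ *: _]addr0; exact: (hardy_lin _ hx hardy0). Qed.

Lemma hardyB x y : hardy x -> hardy y -> hardy (x - y).
Proof. by move=> hx hy; apply: hardyD => //; rewrite -scaleN1r; exact: hardyZ. Qed.

(** Fourier coefficients are continuous for the L^2 norm, by Cauchy-Schwarz. *)
Lemma hardy_closed v (h : nat -> L2T R) : (forall n, hardy (h n)) ->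
  (forall n, sqnorm (v - h n) <= 2 * 4^-1 ^+ n) -> hardy v.
Proof.
move=> hh vh n n0; apply: Normc.eq0_normc; apply/eqP; rewrite -sqrf_eq0; apply/eqP.
apply: (@le_geometric_eq0 _ _ (2 * sqnorm (zpow R n))); first exact: sqr_ge0.
move=> k; have -> : ip v (zpow R n) = ip (v - h k) (zpow R n) by rewrite ipBl hh// subr0.
apply: le_trans (cauchy_schwarz _ _) _.
by rewrite mulrAC ler_wpM2r// sqnorm_ge0.
Qed.

(** A projection exists for every x in L^2, so the choice that defines Pplus never
    takes its default value. *)
Lemma PplusP (x : circle R -> C) : L2 x ->
  H2 (Pplus x) /\ forall h : circle R -> C, H2 h -> inner (x \- Pplus x) h = 0.
Proof.
move=> xL; rewrite /Pplus; case: xgetP => [y _ Py|noP]; first exact: Py.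
have [x' xE] := L2T_of xL.
have [v [hv vP]] := orthogonal_projection hardy0 hardy_lin hardy_closed x'.
exfalso; apply: (noP (L2val v)); split; first exact/H2E.
move=> h [hL hH]; have [k kE] := L2T_of hL.
have hk : hardy k by apply/H2E; rewrite kE.
by have := vP _ hk; rewrite ip.unlock kE -xE.
Qed.

Lemma L2_Pplus (x : circle R -> C) : L2 x -> L2 (Pplus x).
Proof. by move=> /PplusP[[]]. Qed.

End HardySpace.

HB.lock Definition proj (R : realType) (x : L2T R) : L2T R :=
  MkL2 (mem_set (L2_Pplus (L2TP x)) : _ \in @L2pred R).

Section HardyProjection.
Variable R : realType.
Local Notation C := R[i].
Local Notation one := (zpow R 0).
Local Notation e := (zpow R (-1)).
Implicit Types (x y u v h : L2T R) (f g : circle R -> C).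

Lemma projE x : proj x = Pplus x :> (_ -> _).
Proof. by rewrite unlock. Qed.

Lemma hardy_proj x : hardy (proj x).
Proof. by apply/H2E; rewrite projE; case: (PplusP (L2TP x)). Qed.

Lemma proj_orth x h : hardy h -> ip (x - proj x) h = 0.
Proof.
move=> /H2E hh; rewrite ip.unlock -[L2val _]/((x : _ -> C) \- proj x) projE.
exact: (PplusP (L2TP x)).2.
Qed.

(** Two projections of x differ by a vector that lies in H^2 and is orthogonal to
    H^2, hence is null; this is the uniqueness that almost everywhere equality
    permits. *)
Lemma proj_unique x w : hardy w -> (forall h, hardy h -> ip (x - w) h = 0) ->
  forall u, ip (proj x) u = ip w u.
Proof.
move=> hw xw u; apply/eqP; rewrite -subr_eq0 -ipBl; apply/eqP; apply: ip_null.
apply: (@complexI R); rewrite -ipxx.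
have hd : hardy (proj x - w) by apply: hardyB => //; exact: hardy_proj.
have dE : proj x - w = (x - w) - (x - proj x).
  by rewrite opprB [RHS]addrC addrA subrK.
by rewrite [X in ip X _]dE ipBl xw// proj_orth// subr0.
Qed.

Lemma ip_projr x y : ip (proj x) y = ip (proj x) (proj y).
Proof.
apply/eqP; rewrite -subr_eq0 -ipBr; apply/eqP.
by rewrite ipC proj_orth ?conjC0//; exact: hardy_proj.
Qed.

Lemma ip_proj x y : ip (proj x) y = ip x (proj y).
Proof. by rewrite ip_projr [RHS]ipC (ip_projr y) -ipC. Qed.

Lemma hardy_one : hardy one.
Proof.
move=> n n0; rewrite ip.unlock /inner !zpowE.
transitivity (cintegral (fun z : circle R => val z ^+ `|n|%N)); last first.
  by apply: circle_exp_mean; rewrite absz_gt0 lt_eqF.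
have nE : n = - (`|n|%N%:Z) by rewrite ltz0_abs// opprK.
congr cintegral; apply/funext => z.
by rewrite /= expr0z mul1r [in LHS]nE circle_exp_negz conjCK.
Qed.

Lemma hardy_shift x : hardy x -> hardy (shift x).
Proof.
move=> hx n n0; have -> : zpow R n = shift (zpow R (n - 1)) by rewrite shift_zpow addrC subrK.
by rewrite ip_shift hx// ltrBlDr (lt_trans n0).
Qed.

(** P (z x) = z P x + <x, 1/z> 1: the shift commutes with P except that it moves
    the coefficient of index -1 into H^2. The orthogonality to H^2 is tested on
    h = h(0) + z h1, where h1 is again in H^2. *)
Lemma ip_proj_shift x u : ip (proj (shift x)) u = ip (shift (proj x) + ip x e *: one) u.
Proof.
apply: proj_unique.
  by apply: hardyD; [apply: hardy_shift; exact: hardy_proj|apply: hardyZ; exact: hardy_one].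
move=> h hh; pose h1 := unshift (h - ip h one *: one).
have hE : h = ip h one *: one + shift h1 by rewrite shiftK addrC subrK.
have hh1 : hardy h1.
  move=> n n0; rewrite -ip_shift shiftK shift_zpow ipBl ipZl.
  have [->|n1] := eqVneq n (-1).
    by rewrite subrr ip_zpow_diag mulr1 subrr.
  have n2 : 1 + n < 0 by move: n0 n1; case: n => // -[].
  by rewrite hh// hardy_one// mulr0 subr0.
have -> : shift x - (shift (proj x) + ip x e *: one) = shift (x - proj x - ip x e *: e).
  by rewrite one_shift !shiftB shiftZ opprD addrA.
rewrite hE one_shift -shiftZ -shiftD ip_shift ipDr ipZr !ipBl !ipZl.
rewrite (hardy_proj x)// ip_zpow_diag -(ipBl x) proj_orth// (ipC h1) hh1//.
by rewrite conjC0; ring.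
Qed.

End HardyProjection.

(** * Normality as an identity of sesquilinear forms *)

Section SingularIntegral.
Variable R : realType.
Local Notation C := R[i].
Local Notation mu := (circle_measure R).
Implicit Types x y u v h : L2T R.
Variables f g : circle R -> C.
Hypothesis hf : Linfty f.
Hypothesis hg : Linfty g.
Local Notation Mf := (mulT hf).
Local Notation Mg := (mulT hg).
Local Notation Mf' := (mulT (Linfty_conj hf)).
Local Notation Mg' := (mulT (Linfty_conj hg)).

Definition singop x : L2T R := Mf (proj x) + Mg (x - proj x).
Definition singop_adj x : L2T R := proj (Mf' x) + (Mg' x - proj (Mg' x)).

Lemma singular_integralE x : singular_integral f g x = L2val (singop x).
Proof.
apply/funext => z; rewrite -[RHS]/(Mf (proj x) z + Mg (x - proj x) z) !mulTE.
by rewrite -[(x - proj x) z]/(x z - proj x z) projE.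
Qed.

Lemma ip_singop x y : ip (singop x) y = ip x (singop_adj y).
Proof.
rewrite /singop /singop_adj ipDl !ip_mulT ip_proj ipBl ip_proj.
by rewrite ipDr ipBr.
Qed.

Lemma ip_eq_ae x y : (forall u, ip x u = ip y u) -> \forall z \ae mu, x z = y z.
Proof.
move=> xy; have d0 : sqnorm (x - y) = 0.
  by apply: (@complexI R); rewrite -ipxx ipBl xy subrr.
by apply: filterS (sqnorm_eq0 d0) => z /eqP; rewrite subr_eq0 => /eqP.
Qed.

(** If A is an adjoint of S, then <S A x, y> = <A x, A y> and
    <A S x, y> = <S x, S y>; moreover A x agrees almost everywhere with
    singop_adj x, because an adjoint is unique. *)
Lemma normal_singopP : normal_operator (singular_integral f g) <->
  forall x y, ip (singop_adj x) (singop_adj y) = ip (singop x) (singop y).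
Proof.
split=> [[A [[AL adjA] comm]] x y|form].
  have liftA v : {w : L2T R | L2val w = A v} by apply: L2T_of; apply: AL; exact: L2TP.
  pose B v := sval (liftA v); have BE v : L2val (B v) = A v := svalP (liftA v).
  have adjB u v : ip (singop u) v = ip u (B v).
    by have := adjA u v (L2TP u) (L2TP v); rewrite ip.unlock BE singular_integralE.
  have BS u v : ip u (B v) = ip u (singop_adj v) by rewrite -adjB ip_singop.
  have -> : ip (singop_adj x) (singop_adj y) = ip (B x) (B y).
    by rewrite BS [LHS]ipC [RHS]ipC BS.
  have -> : ip (singop x) (singop y) = ip (B (singop x)) y.
    by rewrite [LHS]ipC adjB -ipC.
  rewrite -adjB; apply: ip_ae.
  have := comm _ (L2TP x); apply: filterS => z /(_ I) E; congr (_ * _).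
  by rewrite -(singular_integralE (B x)) !BE -(singular_integralE x).
pose A (y : circle R -> C) :=
  Pplus (fun z => (f z)^* * y z) \+ Pminus (fun z => (g z)^* * y z).
have AE y : A y = L2val (singop_adj y).
  apply/funext => z.
  by rewrite -[RHS]/(proj (Mf' y) z + (Mg' y z - proj (Mg' y) z)) !projE !mulTfE.
exists A; split; first split.
- by move=> _ /L2T_of[y <-]; rewrite AE; exact: L2TP.
- move=> _ _ /L2T_of[x <-] /L2T_of[y <-]; rewrite AE singular_integralE.
  by have := ip_singop x y; rewrite ip.unlock.
move=> _ /L2T_of[x <-].
have SE y := singular_integralE y.
rewrite AE !SE AE.
have : \forall z \ae mu, (singop (singop_adj x)) z = (singop_adj (singop x)) z.
  by apply: ip_eq_ae => u; rewrite ip_singop form [RHS]ipC -ip_singop -ipC.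
by apply: filterS => z ->.
Qed.

End SingularIntegral.

(** * The relations between f and g *)

Section Characterization.
Variable R : realType.
Local Notation C := R[i].
Local Notation mu := (circle_measure R).
Local Notation one := (zpow R 0).
Local Notation e := (zpow R (-1)).
Implicit Types x y u v h : L2T R.
Variables f g : circle R -> C.
Hypothesis hf : Linfty f.
Hypothesis hg : Linfty g.
Local Notation Mf := (mulT hf).
Local Notation Mg := (mulT hg).
Local Notation Mf' := (mulT (Linfty_conj hf)).
Local Notation Mg' := (mulT (Linfty_conj hg)).
Local Notation S := (singop hf hg).
Local Notation S' := (singop_adj hf hg).

Lemma ip_proj_coproj x y : ip (proj x) (y - proj y) = 0.
Proof. by rewrite ipBr ip_projr subrr. Qed.

Lemma ip_coproj_proj x y : ip (y - proj y) (proj x) = 0.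
Proof. by rewrite ipC ip_proj_coproj conjC0. Qed.

Lemma ip_singop_adj x y : ip (S' x) (S' y) =
  ip (proj (Mf' x)) (proj (Mf' y)) + ip (Mg' x) (Mg' y) - ip (proj (Mg' x)) (proj (Mg' y)).
Proof.
rewrite /singop_adj; move: (Mf' x) (Mf' y) (Mg' x) (Mg' y) => a b a' b'.
rewrite !(ipDl, ipDr, ipNl, ipNr) (ip_projr a b') -(ip_proj a' b) (ip_projr a' b).
by rewrite -(ip_proj a' b') (ip_projr a' b'); ring.
Qed.

(** If the rank one forms x |-> |<x, u>|^2 and x |-> |<x, v>|^2 agree at u and at
    v, then equality holds in the Cauchy-Schwarz inequality for u and v, and the
    two vectors have the same norm. *)
Lemma rank_one_eq u v : ip u u * (ip u u)^* = ip u v * (ip u v)^* ->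
  ip v u * (ip v u)^* = ip v v * (ip v v)^* ->
  exists lambda : C, `|lambda| = 1 /\ sqnorm (u - lambda *: v) = 0.
Proof.
move=> kF; rewrite [ip v u]ipC conjCK => kG.
have rr : ip u u = ip v v.
  have : ip u u * ip u u = ip v v * ip v v.
    by rewrite {2}ipC kF mulrC kG -ipC.
  rewrite !ipxx -!rmorphM /= => /(@complexI R) /eqP; rewrite -!expr2.
  by rewrite eqrXn2 ?sqnorm_ge0// => /eqP ->.
have [v0|v0] := eqVneq (sqnorm v) 0.
  exists 1; split; first by rewrite normr1.
  apply: (@complexI R); rewrite -ipxx scale1r !(ipBl, ipBr).
  have u0 : sqnorm u = 0 by apply: (@complexI R); rewrite -ipxx rr ipxx v0.
  by rewrite !(ip_null _ u0) !(ip_null _ v0); ring.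
have r0 : ip v v != 0 by rewrite ipxx; apply: contra v0 => /eqP/(@complexI R)->.
have rconj : (ip v v)^* = ip v v by rewrite -ipC.
(* lambda v is the component of u along v *)
exists (ip u v / ip v v); split.
  apply/eqP; rewrite -(@pexpr_eq1 _ _ 2)// normCK rmorphM fmorphV /= rconj.
  by rewrite mulrACA -kF -ipC rr -mulrA mulVKf// divff.
apply: (@complexI R); rewrite -ipxx !(ipBl, ipBr, ipZl, ipZr) rmorphM fmorphV /= rconj.
have ss : ip u v * (ip u v)^* = ip v v * ip v v by rewrite -kF -ipC rr.
rewrite (ipC u v) rr.
apply: (@etrans _ _ (ip v v - ip u v * (ip u v)^* / ip v v)); first by field.
by rewrite ss mulfK// subrr.
Qed.

Section Necessity.
Hypothesis form : forall x y, ip (S' x) (S' y) = ip (S x) (S y).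
Let F := Mf e.
Let G := Mg e.
Let D := Mf one - Mg one.
Let d := F - G.

Lemma ip_proj_shift_shift x y : ip (proj (shift x)) (proj (shift y)) =
  ip (proj x) (proj y) + ip x e * (ip y e)^*.
Proof.
rewrite -ip_projr ip_proj_shift ipDl ipZl ip_shift ip_projr; congr (_ + _ * _).
by rewrite ip_one_shift.
Qed.

Lemma ip_singop_shift x u : ip (S (shift x)) u = ip (shift (S x) + ip x e *: D) u.
Proof.
rewrite /singop ipDl !ip_mulT ipBl !ip_proj_shift.
rewrite /D shiftD -!mulT_shift shiftB !(ipBl, ipDl, ipZl, ip_mulT, ipNl).
ring.
Qed.

Lemma ip_shift_perturb u v w (a b : C) :
  ip (shift u + a *: shift w) (shift v + b *: shift w) =
  ip u v + (a * (ip v w)^* + b^* * ip u w + a * b^* * ip w w).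
Proof. by rewrite !(ipDl, ipDr, ipZl, ipZr, ip_shift) (ipC v w); ring. Qed.

(** The identity of forms at (z x, z y) minus the one at (x, y). All terms that
    commute with the shift cancel; what remains is of rank at most two and comes
    from the extra term in P (z x), once for each of the two operators. *)
Lemma rank_identity x y :
  ip x F * (ip y F)^* - ip x G * (ip y G)^* =
  ip x e * (ip (S y) d)^* + (ip y e)^* * ip (S x) d + ip x e * (ip y e)^* * ip d d.
Proof.
have S'shift u v : ip (S' (shift u)) (S' (shift v)) = ip (S' u) (S' v) +
    (ip u F * (ip v F)^* - ip u G * (ip v G)^*).
  rewrite !ip_singop_adj !mulT_shift !ip_proj_shift_shift ip_shift /F /G !ip_mulTr.
  by ring.
have Dd : D = shift d.
  by rewrite /d shiftB /F /G -!mulT_shift -one_shift.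
have Sshift u v : ip (S (shift u)) (S (shift v)) = ip (S u) (S v) +
   (ip u e * (ip (S v) d)^* + (ip v e)^* * ip (S u) d + ip u e * (ip v e)^* * ip d d).
  rewrite ip_singop_shift ipC ip_singop_shift -ipC.
  by rewrite Dd ip_shift_perturb.
have := form (shift x) (shift y).
by rewrite S'shift Sshift form => /addrI.
Qed.

Let F0 := F - ip F e *: e.
Let G0 := G - ip G e *: e.

Lemma ip_residual_e x : ip (x - ip x e *: e) e = 0.
Proof. by rewrite ipBl ipZl ip_zpow_diag mulr1 subrr. Qed.

Lemma ip_residual x u : ip u e = 0 -> ip u x = ip u (x - ip x e *: e).
Proof. by move=> ue; rewrite ipBr ipZr ue mulr0 subr0. Qed.

(** For x and y orthogonal to e the right-hand side of rank_identity vanishes, so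
    the parts of F and G orthogonal to e define the same rank one form. *)
Lemma residual_proportional : exists lambda : C, `|lambda| = 1 /\
  sqnorm (F0 - lambda *: G0) = 0.
Proof.
have F0e : ip F0 e = 0 := ip_residual_e F.
have G0e : ip G0 e = 0 := ip_residual_e G.
have key u : ip u e = 0 -> ip u F0 * (ip u F0)^* = ip u G0 * (ip u G0)^*.
  move=> ue; have := rank_identity u u; rewrite ue conjC0 !mul0r !addr0.
  by rewrite (ip_residual F ue) (ip_residual G ue) => /eqP; rewrite subr_eq0 => /eqP.
exact: rank_one_eq (key _ F0e) (key _ G0e).
Qed.

Section Relation.
Variables lambda k : C.
Hypothesis lambda1 : `|lambda| = 1.
Hypothesis fgk : \forall z \ae mu, f z = lambda * g z + k.

Let ll : lambda * lambda^* = 1. Proof. by rewrite -normCK lambda1 expr1n. Qed.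

Lemma ip_mulT_relation x u : ip (Mf x) u = lambda * ip (Mg x) u + k * ip x u.
Proof.
rewrite -!ipZl -ipDl; apply: ip_ae; apply: filterS fgk => z fz; congr (_ * _).
rewrite -[RHS]/(lambda * Mg x z + k * x z) !mulTE fz; ring.
Qed.

Lemma ip_F_relation u : ip u F = lambda^* * ip u G + k^* * ip u e.
Proof. by rewrite /F ipC ip_mulT_relation rmorphD !rmorphM /= -!ipC. Qed.

(** This is rank_identity at y = e, with F = lambda G + k e. *)
Lemma ip_singop_diff x : ip x e = 0 -> ip (S x) d = lambda^* * k * ip x G.
Proof.
move=> xe; have := rank_identity x e; rewrite xe ip_zpow_diag conjC1 mul1r !mul0r addr0 add0r.
rewrite !ip_F_relation xe ip_zpow_diag mulr0 addr0 mulr1 rmorphD rmorphM /= !conjCK => <-.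
rewrite mulrDr; have -> : lambda^* * ip x G * (lambda * (ip e G)^*) =
   (lambda * lambda^*) * (ip x G * (ip e G)^*) by ring.
by rewrite ll; ring.
Qed.

Lemma ip_singop_proj x u : ip (S (proj x)) u = ip (Mf (proj x)) u.
Proof.
rewrite /singop ipDl !ip_mulT ipBl.
have PP v : ip (proj (proj x)) v = ip (proj x) v by rewrite ip_proj -ip_projr.
by rewrite !PP subrr addr0.
Qed.

Lemma ip_singop_coproj x u : ip (S (x - proj x)) u = ip (Mg (x - proj x)) u.
Proof.
rewrite /singop ipDl !ip_mulT ipBl.
have PQ v : ip (proj (x - proj x)) v = 0 by rewrite ip_proj ip_coproj_proj.
by rewrite !PQ subr0 add0r.
Qed.

(* The function (f conj(g) - lambda conj(f) g) / z. *)
Let v := Mf (Mg' e) - lambda *: Mf' (Mg e).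

Let ip_v x : ip x v = ip (Mg x) F - lambda^* * ip (Mf x) G.
Proof. by rewrite /v ipBr ipZr /F /G !ip_mulT (mulTC (Linfty_conj hg)). Qed.

(** If x is orthogonal to e, then so are P x and x - P x. On the first S is
    multiplication by f, on the second multiplication by g, and in both cases
    ip_singop_diff says exactly that the vector is orthogonal to v. Hence v is
    orthogonal to everything that is orthogonal to e. *)
Lemma cross_term_constant : sqnorm (v - ip v e *: e) = 0.
Proof.
have kG x : lambda^* * k * ip x G = lambda^* * ip (Mf x) G - ip (Mg x) G.
  rewrite ip_mulT_relation; apply: (@etrans _ _ (lambda^* * (lambda * ip (Mg x) G + k * ip x G)
     - (lambda * lambda^*) * ip (Mg x) G)); last by rewrite ll mul1r.
  by ring.
have xv x : ip x e = 0 -> ip x v = 0.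
  move=> xe; have pe : ip (proj x) e = 0 by exact: hardy_proj.
  have qe : ip (x - proj x) e = 0 by rewrite ipBl xe pe subrr.
  have -> : x = proj x + (x - proj x) by rewrite addrC subrK.
  rewrite ipDl (_ : ip (proj x) v = 0) ?add0r; last first.
    have := ip_singop_diff pe; rewrite ip_singop_proj kG ipBr ip_v.
    have -> : ip (Mf (proj x)) F = lambda * ip (Mg (proj x)) F + lambda^* * k * ip (proj x) G.
      by rewrite ip_mulT_relation [ip (proj x) F]ip_F_relation pe mulr0 addr0; ring.
    rewrite kG => E.
    have E2 : lambda * ip (Mg (proj x)) F = ip (Mf (proj x)) G.
      by apply/eqP; rewrite -subr_eq0; apply/eqP; move/eqP: E; rewrite -subr_eq0 => /eqP <-; ring.
    by rewrite -E2 mulrA [lambda^* * _]mulrC ll mul1r subrr.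
  have := ip_singop_diff qe; rewrite ip_singop_coproj kG ipBr ip_v => /eqP.
  by rewrite -subr_eq0 => /eqP E; rewrite -[RHS]E; ring.
apply: (@complexI R); rewrite -ipxx.
have ve := ip_residual_e v.
by rewrite -ip_residual// xv.
Qed.

End Relation.

Lemma normal_relations : exists lambda : C, `|lambda| = 1 /\
  is_constant (fun z => f z - lambda * g z) /\
  is_constant (fun z => lambda * (f z)^* * g z - f z * (g z)^*).
Proof.
have [lambda [lambda1 FG0]] := residual_proportional.
exists lambda; split=> //.
have fgk : \forall z \ae mu, f z = lambda * g z + (ip F e - lambda * ip G e).
  apply: filterS (sqnorm_eq0 FG0) => z.
  rewrite -[X in X = 0 -> _]/((F z - ip F e * e z) - lambda * (G z - ip G e * e z)).
  rewrite /F /G !mulTE zpowE => E.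
  have z0 : val z ^ (-1) != 0 :> C by rewrite -normr_eq0 circle_pow_norm oner_eq0.
  apply/eqP; rewrite -subr_eq0 -(mulIr_eq0 _ (mulIf z0)); apply/eqP.
  by rewrite -[RHS]E; ring.
split.
  exists (ip F e - lambda * ip G e); apply: filterS fgk => z -> _.
  by rewrite addrC addKr.
have v0 := cross_term_constant lambda1 fgk.
set v := (X in X - _ *: _) in v0.
exists (- ip v e); apply: filterS (sqnorm_eq0 v0) => z + _.
rewrite -[X in X = 0 -> _]/(Mf (Mg' e) z - lambda * Mf' (Mg e) z - ip v e * e z).
rewrite !mulTE zpowE => E.
have z0 : val z ^ (-1) != 0 :> C by rewrite -normr_eq0 circle_pow_norm oner_eq0.
apply/eqP; rewrite -subr_eq0 -(mulIr_eq0 _ (mulIf z0)); apply/eqP.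
by rewrite -[RHS]oppr0 -E /=; ring.
Qed.

End Necessity.

Section Sufficiency.
Variables lambda k c : C.
Hypothesis lambda1 : `|lambda| = 1.
Hypothesis fgk : \forall z \ae mu, f z = lambda * g z + k.
Hypothesis fgc : \forall z \ae mu, lambda * (f z)^* * g z - f z * (g z)^* = c.

Let ll : lambda * lambda^* = 1. Proof. by rewrite -normCK lambda1 expr1n. Qed.
Let formMf x u : ip (Mf x) u = lambda * ip (Mg x) u + k * ip x u := ip_mulT_relation fgk x u.
Let formMfr x u : ip u (Mf x) = lambda^* * ip u (Mg x) + k^* * ip u x.
Proof. by rewrite ipC formMf rmorphD !rmorphM /= -!ipC. Qed.

Let cross_form x y : lambda * ip (Mg x) (Mf y) - ip (Mf x) (Mg y) = c * ip x y.
Proof.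
rewrite (ip_mulTr hf) (ip_mulTr hg) -!ipZl -ipBl; apply: ip_ae.
apply: filterS fgc => z fgz; congr (_ * _).
rewrite -[LHS]/(lambda * Mf' (Mg x) z - Mg' (Mf x) z) !mulTE.
by rewrite -[RHS]/(c * x z) -fgz; ring.
Qed.

(** Both forms are expanded along x = p + q and y = p' + q' with p = P x and
    p' = P y. The first relation rewrites f in terms of g; in the mixed terms,
    where f and g meet, the second one leaves c <p, q'> and c <q, p'>, which vanish. *)
Lemma relations_normal x y : ip (S' x) (S' y) = ip (S x) (S y).
Proof.
rewrite ip_singop_adj.
have PF u v : ip (proj (Mf' u)) v = lambda^* * ip (proj (Mg' u)) v + k^* * ip (proj u) v.
  by rewrite !ip_proj -!ip_mulTr formMfr.
have PFr u v : ip v (proj (Mf' u)) = lambda * ip v (proj (Mg' u)) + k * ip v (proj u).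
  by rewrite ipC PF rmorphD !rmorphM /= !conjCK -!ipC.
have -> : ip (proj (Mf' x)) (proj (Mf' y)) =
    ip (proj (Mg' x)) (proj (Mg' y)) + lambda^* * k * ip (Mg' x) (proj y) +
    lambda * k^* * ip (proj x) (Mg' y) + k * k^* * ip (proj x) (proj y).
  rewrite PF !PFr -(ip_proj (Mg' x)) (ip_projr (Mg' x) y) -(ip_projr x (Mg' y)).
  by rewrite -[ip (proj (Mg' x)) (proj (Mg' y)) in RHS]mul1r -ll; ring.
have xE : x = proj x + (x - proj x) by rewrite addrC subrK.
have yE : y = proj y + (y - proj y) by rewrite addrC subrK.
have pq : ip (proj x) (y - proj y) = 0 := ip_proj_coproj x y.
have qp : ip (x - proj x) (proj y) = 0 := ip_coproj_proj y x.
rewrite -(ip_mulTr hg x (proj y)) -(ip_mulT hg (proj x) y).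
have gg : ip (Mg' x) (Mg' y) = ip (Mg x) (Mg y) by rewrite -!ip_mulT mulTC ip_mulTr.
rewrite gg /singop !(ipDl, ipDr).
move: (proj x) (x - proj x) (proj y) (y - proj y) xE yE pq qp => p q p' q' -> -> pq qp.
have E1 : ip (Mf p) (Mf p') = ip (Mg p) (Mg p') + lambda * k^* * ip (Mg p) p' +
   lambda^* * k * ip p (Mg p') + k * k^* * ip p p'.
  by rewrite formMf !formMfr -[ip (Mg p) (Mg p') in RHS]mul1r -ll; ring.
have E2 : ip (Mf p) (Mg q') = ip (Mg p) (Mg q') + lambda * k^* * ip (Mg p) q'.
  have /eqP := cross_form p q'; rewrite pq mulr0 subr_eq0 => /eqP <-.
  by rewrite formMfr -[ip (Mg p) (Mg q') in RHS]mul1r -ll; ring.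
have E3 : ip (Mg q) (Mf p') = ip (Mg q) (Mg p') + lambda^* * k * ip q (Mg p').
  have /eqP := cross_form q p'; rewrite qp mulr0 subr_eq0 formMf => /eqP E.
  apply: (@etrans _ _ (lambda^* * (lambda * ip (Mg q) (Mf p')))).
    by rewrite mulrA [lambda^* * _]mulrC ll mul1r.
  rewrite E.
  by rewrite -[ip (Mg q) (Mg p') in RHS]mul1r -ll; ring.
rewrite E1 E2 E3 !(mulTD, ipDl, ipDr).
ring.
Qed.

End Sufficiency.
End Characterization.

Theorem theorem5p11 (R : realType) (f g : circle R -> R[i])
    (hf : Linfty f) (hg : Linfty g) :
  normal_operator (singular_integral f g) <->
  (is_constant f /\ is_constant g) \/
  (exists lambda : R[i], `|lambda| = 1 /\
     is_constant (fun z => f z - lambda * g z) /\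
     is_constant (fun z => lambda * (f z)^* * g z - f z * (g z)^*)).
Proof.
apply: iff_trans (normal_singopP hf hg) _; split=> [form|].
  by right; exact: normal_relations form.
suff suf : (exists lambda : R[i], `|lambda| = 1 /\
     is_constant (fun z => f z - lambda * g z) /\
     is_constant (fun z => lambda * (f z)^* * g z - f z * (g z)^*)) ->
     forall x y : L2T R,
       ip (singop_adj hf hg x) (singop_adj hf hg y) = ip (singop hf hg x) (singop hf hg y).
  case=> [[[a fa] [b gb]]|//]; apply: suf; exists 1; split; first by rewrite normr1.
  split.
    exists (a - b); apply: filterS2 fa gb => z /(_ I) /= fz /(_ I) /= gz _.
    by rewrite fz gz mul1r.
  exists (a^* * b - a * b^*); apply: filterS2 fa gb => z /(_ I) /= fz /(_ I) /= gz _.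
  by rewrite fz gz mul1r.
move=> [lambda [lambda1 [[k fk] [c fc]]]] x y.
apply: (@relations_normal _ _ _ hf hg lambda k c lambda1).
  by apply: filterS fk => z /(_ I) /= <-; rewrite addrC subrK.
by apply: filterS fc => z /(_ I).
Qed.
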